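(* Let $\Gamma$ be a set, and let $K\subseteq[0,1]^\Gamma$ be $\tau_p$-compact and satisfy $x\wedge y\in K$ whenever $x,y\in K$. Suppose further that there exists a $\tau_p$-lower semicontinuous function $\rho:K\to[0,1]$ such that: ($*$) if $x,y\in K$ and $y<x$, then there exist $\alpha<\rho(x)$ and a ($\tau_p$-relatively) open set $U\subseteq K$ with $y\in U$ such that if $z\in U$ and $z\le x$, then $\rho(z)<\alpha$. Then: I. $K$ is fragmentable; II. for all $r\in[0,1]$, $(\rho^{-1}(r),\tau_p)$ has a $\sigma$-isolated network. Moreover, if $K\subseteq\{0,1\}^\Gamma$, then: III. $K$ is descriptive.
   Context: $\tau_p$ is the pointwise (product) topology on $\mathbb{R}^\Gamma$, and subsets carry the subspace topology. The order on $\mathbb{R}^\Gamma$ is pointwise; $x\wedge y$ is the pointwise minimum, and $y<x$ means $y\le x$ and $y\neq x$. Let $(Z,\tau)$ be a regular topological space. $Z$ is fragmentable if there exists a metric $d$ on $Z$ such that for any non-empty $E\subseteq Z$ and $\varepsilon>0$ there is a $\tau$-open set $U$ such that $E\cap U$ is non-empty and has $d$-diameter not exceeding $\varepsilon$. A family $\mathscr{N}$ of subsets of $Z$ is a network for $Z$ if, given $x\in U\in\tau$, there is $N\in\mathscr{N}$ with $x\in N\subseteq U$. A family $\mathscr{F}$ of subsets of $Z$ is isolated if $E\cap\overline{\bigcup(\mathscr{F}\setminus\{E\})}=\varnothing$ for every $E\in\mathscr{F}$. A network is $\sigma$-isolated if it can be written as $\bigcup_{n=1}^\infty\mathscr{N}_n$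 with each $\mathscr{N}_n$ isolated. $Z$ is descriptive if it is compact and admits a $\sigma$-isolated network. *)

(* Defs.v *)
From HB Require Import structures.
From mathcomp Require Import all_boot all_order all_algebra.
From mathcomp Require Import all_classical all_reals all_analysis.
Set Implicit Arguments.
Unset Strict Implicit.
Unset Printing Implicit Defensive.
Import Order.TTheory GRing.Theory Num.Theory.
Import numFieldNormedType.Exports.
Local Open Scope classical_set_scope.
Local Open Scope ring_scope.

(* A distance is a bare function, independent of the topology of Z: the
   metric fragmenting a space need not induce its topology, so Z cannot be
   given the library's metricType structure here. *)
Record is_metric (R : realType) (Z : Type) (d : Z -> Z -> R) : Prop := {
  metric_ge0 : forall x y, 0 <= d x y;
  metric_eq0 : forall x y, d x y = 0 <-> x = y;
  metric_symmetric : forall x y, d x y = d y x;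
  metric_trans : forall y x z, d x z <= d x y + d y z
}.

Definition diameter (R : realType) (Z : Type) (d : Z -> Z -> R) (A : set Z)
    : \bar R :=
  ereal_sup [set (d p.1 p.2)%:E | p in A `*` A].

Definition fragmentable (R : realType) (Z : topologicalType) : Prop :=
  exists2 d : Z -> Z -> R, is_metric d &
    forall (E : set Z) (eps : R), E !=set0 -> 0 < eps ->
      exists U : set Z,
        [/\ open U, (E `&` U) !=set0 & (diameter d (E `&` U) <= eps%:E)%E].

Definition network (Z : topologicalType) (N : set (set Z)) : Prop :=
  forall (x : Z) (U : set Z), open U -> U x ->
    exists2 A, N A & A x /\ A `<=` U.

Definition isolated_family (Z : topologicalType) (F : set (set Z)) : Prop :=
  forall E, F E -> E `&` closure (\bigcup_(A in F `\ E) A) = set0.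

Definition sigma_isolated (Z : topologicalType) (N : set (set Z)) : Prop :=
  exists2 N_ : nat -> set (set Z),
    (forall n, isolated_family (N_ n)) & N = \bigcup_n N_ n.

Definition has_sigma_isolated_network (Z : topologicalType) : Prop :=
  exists2 N : set (set Z), network N & sigma_isolated N.

Definition descriptive (Z : topologicalType) : Prop :=
  compact [set: Z] /\ has_sigma_isolated_network Z.

(* The notions above are meant for regular spaces; this and the Hausdorff
   property hold for all the subspaces of a power of R. *)
Fact ptws_subspace_regular (R : realType) (Gamma : Type)
  (K : set {ptws Gamma -> R}) : regular_space K.
Proof. exact: uniform_regular. Qed.

(* Main.v *)
Require Import Defs.
From HB Require Import structures.
From mathcomp Require Import all_boot all_order all_algebra.
From mathcomp Require Import all_classical all_reals all_analysis.
Import Order.TTheory GRing.Theory Num.Theory.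
Import numFieldNormedType.Exports.
Local Open Scope classical_set_scope.
Local Open Scope ring_scope.

(** All three conclusions come from one fact: [K] itself has a sigma-isolated
    network ([semilattice_network]).  The level sets of [rho] inherit it by
    taking traces ([subspace_network]), with the compactness of [K] it makes [K]
    descriptive, and [K] is fragmentable because every Hausdorff space with a
    sigma-isolated network is ([fragmentable_of_network]).

    The network exists on every compact semilattice whose meet is jointly
    continuous and which carries a lower semicontinuous [rho] satisfying
    [rho_star].  Together with compactness, [rho_star] says that [rho] sees the
    topology: if [rho (meet z y)] is nearly as large as [rho z], and [rho y] is
    at most slightly larger than [rho z], then [y] is close to [z]
    ([open_sup_meet_ball]).

    Fix a threshold [a].  If [a < rho z], joint continuity of the meet at
    [(z, z)] gives open sets [U] around [z] on whose pairs [rho (meet x y)]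
    exceeds [a].  When [a] is close to [rho z], the part of such a [U] where
    [rho] is not much above [rho z] is therefore small, whatever [U] is.  Let
    every [z] select the least such [U] in a well-ordering of all the sets.
    Sorting the points by the set they select gives small pieces, but usually
    not an isolated family: every neighbourhood of [z] may meet pieces whose
    label comes earlier than that of [z].  The relation [c < rho (meet z y)]
    repairs this because it is symmetric and open.  Cut each piece down to the
    points [z] that stay well inside their own label [U], in the sense that
    [c < rho (meet z y)] and [rho y <= b] force [y] into [U].  If two such
    points [z] and [y], with labels [U] and [U'], satisfy [c < rho (meet z y)],
    then each of them lies in the label of the other, so both select the same
    set ([pieces_isolated]).
    Letting the three thresholds run over the rationals loses no point, and
    gives the sigma-isolated network. *)

(** * Auxiliary facts on choice and countable indexing *)

(** Take the least element for a well-ordering: under the two hypotheses of the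
    second property, each of [m A] and [m B] precedes the other. *)
Lemma coherent_choice (T : pointedType) :
  exists m : set T -> T,
    (forall A, A !=set0 -> A (m A)) /\
    (forall A B, A (m B) -> B (m A) -> m A = m B).
Proof.
have [r wo_r] := wochoice.well_ordering_principle T.
pose least (A : set T) x := A x /\ forall y, A y -> r x y.
have wo A : A !=set0 -> exists2 x, least A x & forall y, least A y -> x = y.
  move=> [x0 Ax0].
  have [|x [[xA lbx] uniqx]] := wo_r (mem A); first by exists x0; exact/mem_set.
  exists x; first by split=> [|y Ay]; [exact/set_mem|apply: lbx; exact/mem_set].
  move=> y [Ay lby]; apply: uniqx; split; first exact/mem_set.
  by move=> z zA; apply: lby; exact/set_mem.
have r_anti x y : r x y -> r y x -> x = y.
  move=> rxy ryx.
  have rr z : r z z.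
    by have [|w [-> +] _] := wo [set z]; [exists z|exact].
  have [|z [_ _] uniqz] := wo [set x; y]; first by exists x; left.
  rewrite -(uniqz x); first by apply: uniqz; split=> [|w [] ->]; [right| |].
  by split=> [|w [] ->]; [left| |].
pose m (A : set T) := get (least A).
have mP A : A !=set0 -> least A (m A).
  by move=> /wo[x lx _]; apply: getPex; exists x.
exists m; split=> [A /mP[]//|A B AmB BmA].
have [_ lA] : least A (m A) by apply: mP; exists (m B).
have [_ lB] : least B (m B) by apply: mP; exists (m A).
by apply: r_anti; [exact: lA|exact: lB].
Qed.

Lemma sigma_isolated_countable (I : countType) (Z : topologicalType)
    (F : I -> set (set Z)) :
  (forall i, isolated_family (F i)) -> sigma_isolated (\bigcup_i F i).
Proof.
move=> isoF; exists (fun n => if unpickle n is Some i then F i else set0).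
  by move=> n; case: unpickle => [i|E []]; exact: isoF.
apply/seteqP; split=> [E [i _ FE]|E [n _]].
  by exists (pickle i); rewrite ?pickleK.
by case: unpickle => [i FE|[]]; exists i.
Qed.

Lemma set_val_continuous (T : topologicalType) (A : set T) :
  continuous (set_val : A -> T).
Proof. exact: initial_continuous. Qed.

(** * The network of a compact semilattice *)

Section Semilattice.
Context (R : realType) (Z : topologicalType) (meet : Z -> Z -> Z) (rho : Z -> R).
Hypothesis Zcompact : compact [set: Z].
Hypothesis meetA : associative meet.
Hypothesis meetC : commutative meet.
Hypothesis meetxx : idempotent_op meet.
Hypothesis meet_continuous : continuous (fun p : Z * Z => meet p.1 p.2).
Hypothesis rho_lsc : forall a, open [set z | a < rho z].
Hypothesis rho_star : forall x y, meet y x = y -> y <> x ->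
  exists (alpha : R) (U : set Z),
    [/\ alpha < rho x, open U, U y &
        forall z, U z -> meet z x = z -> rho z < alpha].

Lemma meet_continuousr z : continuous (meet z).
Proof.
move=> y; apply: (@continuous_comp _ _ _ (fun t => (z, t)) (fun p => meet p.1 p.2)).
  by apply: cvg_pair => //=; exact: cvg_cst.
exact: meet_continuous.
Qed.

(** A point [y] outside [V] is excluded, together with a neighbourhood and for
    all small [e], for one of two reasons.  If [meet z y] is strictly below
    [z], then [rho_star] keeps [rho (meet z t)] away from [rho z] for [t] near [y].
    Otherwise [z] is strictly below [y]; then [rho_star] gives [rho z < rho y], and
    lower semicontinuity keeps [rho t] away from [rho z] for [t] near [y].
    Compactness makes [e] uniform in [y]. *)
Lemma open_sup_meet_ball (V : set Z) (z : Z) : open V -> V z ->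
  exists2 e : R, 0 < e &
    forall y, rho z - e < rho (meet z y) -> rho y <= rho z + e -> V y.
Proof.
move=> oV Vz.
pose P (e : R) (y : Z) : Prop :=
  rho z - e < rho (meet z y) -> rho y <= rho z + e -> V y.
suff : \forall e \near 0^'+, [set: Z] `<=` P e.
  move=> PF; near (0 : R)^'+ => e; exists e => // y.
  have : [set: Z] `<=` P e by near: e.
  exact.
apply: ((compact_near_coveringP _).1 Zcompact) => y _.
have [Vy|nVy] := pselect (V y).
  exists (V, setT) => [|[t e] [Vt _] _ _ //].
  by split; [exact: open_nbhs_nbhs|exact: filterT].
have [zy|zy] := pselect (meet z y = z).
  have [||alpha [U [alpha_y oU Uz Ualpha]]] := rho_star y z.
  - by [].
  - by move=> eqzy; apply: nVy; rewrite -eqzy.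
  have rz : rho z < alpha by apply: Ualpha.
  exists ([set t | alpha < rho t], [set e | e < alpha - rho z]).
    split=> /=; first by apply: open_nbhs_nbhs; split.
    by apply: nbhs_right_lt; rewrite subr_gt0.
  move=> [t e] /= [rt]; rewrite ltrBrDl => /lt_trans/(_ rt) et _.
  by rewrite leNgt et.
have [||alpha [U [alpha_z oU Uw Ualpha]]] := rho_star z (meet z y).
- by rewrite meetC meetA meetxx.
- by [].
exists (meet z @^-1` U, [set e | e < rho z - alpha]).
  split; first by apply: meet_continuousr; exact: open_nbhs_nbhs.
  by apply: nbhs_right_lt; rewrite subr_gt0.
move=> [t e] /= [Ut]; rewrite ltrBrDl -ltrBrDr => et /(lt_trans et) rt.
have := Ualpha _ Ut; rewrite meetC meetA meetxx => /(_ erefl) /(lt_trans rt).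
by rewrite ltxx.
Unshelve. all: by end_near.
Qed.

Definition meets_above (a : R) (z : Z) : set (set Z) :=
  [set U | [/\ open U, U z & forall x y, U x -> U y -> a < rho (meet x y)]].

Lemma meets_above_ex (a : R) (z : Z) : a < rho z -> meets_above a z !=set0.
Proof.
move=> az.
have := meet_continuous (z, z) [set y | a < rho y].
rewrite /= meetxx => /(_ (open_nbhs_nbhs (conj (rho_lsc a) az))).
move=> [[A B] /= [Az Bz] AB].
have : nbhs z (A `&` B) by exact: filterI.
rewrite nbhsE => -[U [oU Uz] UAB]; exists U; split=> // x y Ux Uy.
by apply: (AB (x, y)); split=> /=; [exact: (UAB x Ux).1|exact: (UAB y Uy).2].
Qed.

(** The points that [m] labels with [U] on the scale [a], and which are well
    inside [U] on the scale [(b, c)].  The scale [a] makes the piece small; the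
    scale [(b, c)] separates pieces with different labels. *)
Definition piece (m : set (set Z) -> set Z) (a b c : R) (U : set Z) : set Z :=
  [set z | [/\ a < rho z, c < rho z, rho z <= b, m (meets_above a z) = U &
    forall y, c < rho (meet z y) -> rho y <= b -> U y]].

(** The neighbourhood of [z] that misses the other pieces consists of the [y]
    in [U] with [c < rho (meet z y)]: if such a [y] has label [U'], then [z] is
    in [U'] by symmetry of the meet.  Hence [U] was
    available to [y] and [U'] to [z], and coherence of [m] makes the two
    labels equal. *)
Lemma pieces_isolated (m : set (set Z) -> set Z) (a b c : R) :
  (forall A, A !=set0 -> A (m A)) ->
  (forall A B, A (m B) -> B (m A) -> m A = m B) ->
  isolated_family (range (piece m a b c)).
Proof.
move=> mP m_coh _ [U _ <-]; rewrite -subset0 => z [[az cz zb mzU _]] clz.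
have label y : a < rho y -> meets_above a y (m (meets_above a y)).
  by move=> ay; apply: mP; exact: meets_above_ex.
have [oU Uz meetU] : meets_above a z U by rewrite -mzU; exact: label.
have nbhs_z : nbhs z (U `&` [set y | c < rho (meet z y)]).
  apply: filterI; first exact: open_nbhs_nbhs.
  apply: (meet_continuousr z z [set y | c < rho y]); apply: open_nbhs_nbhs.
  by split; [exact: (rho_lsc c)|rewrite /= meetxx].
have [y [[_ [[U' _ <-] neq]] [ay _ _ myU' U'y] [Uy cmeet]]] := clz _ nbhs_z.
apply: neq => /=; congr (piece m a b c _).
have [oU' _ meetU'] : meets_above a y U' by rewrite -myU'; exact: label.
rewrite -myU' -mzU; apply: m_coh; first by rewrite mzU.
by rewrite myU'; split=> //; apply: U'y => //; rewrite meetC.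
Qed.

Theorem semilattice_network : has_sigma_isolated_network Z.
Proof.
have [m [mP m_coh]] := coherent_choice (set Z).
pose N (i : rat * rat * rat) :=
  range (piece m (ratr i.1.1) (ratr i.1.2) (ratr i.2)).
exists (\bigcup_i N i); last first.
  by apply: sigma_isolated_countable => i; exact: pieces_isolated.
move=> z V oV Vz.
have [e e0 eV] := open_sup_meet_ball V z oV Vz.
have ratD (x y : R) : x < y -> exists2 q : rat, x < ratr q & ratr q < y.
  by move=> /rat_in_itvoo[q]; rewrite in_itv /= => /andP[]; exists q.
have [p ep pz] : exists2 q : rat, rho z - e < ratr q & ratr q < rho z.
  by apply: ratD; rewrite ltrBlDr ltrDl.
have [] : meets_above (ratr p) z (m (meets_above (ratr p) z)).
  by apply: mP; exact: meets_above_ex.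
set U := m _ => oU Uz meetU.
(* The scale [(b, c)] can only be chosen once the label [U] is known. *)
have [f f0 fU] := open_sup_meet_ball U z oU Uz.
have [s fs sz] : exists2 q : rat, rho z - f < ratr q & ratr q < rho z.
  by apply: ratD; rewrite ltrBlDr ltrDl.
have [q zq qef] :
    exists2 q : rat, rho z < ratr q & ratr q < rho z + Num.min e f.
  by apply: ratD; rewrite ltrDl lt_min e0.
have [qe qf] : ratr q <= rho z + e /\ ratr q <= rho z + f.
  by split; apply: (le_trans (ltW qef)); rewrite lerD2l ge_min lexx ?orbT.
have zU : piece m (ratr p) (ratr q) (ratr s) U z.
  split=> //; first exact: ltW.
  move=> y sy yq; apply: fU; first exact: lt_trans sy.
  exact: le_trans qf.
exists (piece m (ratr p) (ratr q) (ratr s) U).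
  by exists (p, q, s) => //; exists U.
split=> // y [py _ yq myU _].
have [_ Uy _] : meets_above (ratr p) y U.
  by rewrite -myU; apply: mP; exact: meets_above_ex.
apply: eV; last exact: le_trans qe.
by apply: (lt_trans ep); exact: meetU.
Qed.

End Semilattice.

(** * Fragmentability and subspaces *)

Definition locally_single (Z : topologicalType) (e : Z -> Z -> Prop) :=
  forall E : set Z, E !=set0 ->
    exists U, [/\ open U, (E `&` U) !=set0 &
      forall x y, (E `&` U) x -> (E `&` U) y -> e x y].

(** The metric is the ultrametric [d x y = 1 / (n + 1)], for the first [n] with
    [x] and [y] not [e n]-equivalent.  It is written as a supremum over all
    such [n], to which [0] is added to cover the case [x = y].  Small sets are
    found by making the first few relations trivial, one after the other. *)
Lemma fragmentable_equivalences (R : realType) (Z : topologicalType)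
    (e : nat -> Z -> Z -> Prop) :
  (forall n x, e n x x) ->
  (forall n x y, e n x y -> e n y x) ->
  (forall n x y z, e n x y -> e n y z -> e n x z) ->
  (forall n, locally_single Z (e n)) ->
  (forall x y, (forall n, e n x y) -> x = y) ->
  fragmentable R Z.
Proof.
move=> e_refl e_sym e_trans e_loc e_sep.
pose D (x y : Z) : set R := 0 |` [set n.+1%:R^-1 | n in [set n | ~ e n x y]].
have D_has_sup x y : has_sup (D x y).
  split; first by exists 0; left.
  by exists 1 => _ [->|[n _ <-]] //; rewrite invf_le1 ?ler1n.
have D_le x y r : (forall n, ~ e n x y -> n.+1%:R^-1 <= r) -> 0 <= r ->
    sup (D x y) <= r.
  move=> nr r0; apply: ge_sup; first by exists 0; left.
  by move=> _ [->|[n /nr ? <-]].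
have D_ge x y n : ~ e n x y -> n.+1%:R^-1 <= sup (D x y).
  by move=> nexy; apply: ub_le_sup; [exact: (D_has_sup x y).2|right; exists n].
have D_ge0 x y : 0 <= sup (D x y).
  by apply: ub_le_sup; [exact: (D_has_sup x y).2|left].
exists (fun x y => sup (D x y)).
  split=> // [x y|x y|y x z].
  - split=> [D_eq0|->].
      apply: e_sep => n; apply: contrapT => /D_ge.
      by rewrite D_eq0 leNgt invr_gt0 ltr0n.
    by apply/eqP; rewrite eq_le D_ge0 andbT; apply: D_le => // n /(_ (e_refl n y)).
  - congr sup; rewrite /D; congr (_ |` [set _ | _ in _]).
    by apply/seteqP; split=> n /=; apply: contra_not; exact: e_sym.
  - apply: D_le => [n nexz|]; last exact: addr_ge0.
    have [exy|nexy] := pselect (e n x y).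
      rewrite ler_wpDl ?D_ge //; apply: contra_not nexz; exact: e_trans.
    by rewrite ler_wpDr ?D_ge.
move=> E eps E0 eps0.
have iter_loc n : exists U, [/\ open U, (E `&` U) !=set0 &
    forall x y, (E `&` U) x -> (E `&` U) y -> forall i, (i < n)%N -> e i x y].
  elim: n => [|n [U [oU EU0 eU]]].
    by exists setT; split=> //; [exact: openT|rewrite setIT].
  have [V [oV EUV0 eV]] := e_loc n _ EU0.
  exists (U `&` V); split; [exact: openI|by rewrite setIA|].
  rewrite setIA => x y EUVx EUVy i; rewrite ltnS leq_eqVlt => /predU1P[->|].
    exact: eV.
  by apply: eU; [exact: EUVx.1|exact: EUVy.1].
pose N := Num.truncn eps^-1.
have [U [oU EU0 eU]] := iter_loc N.
exists U; split=> //; apply: ge_ereal_sup => _ [[x y] [EUx EUy] <-] /=.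
rewrite lee_fin; apply: D_le => [n nexy|]; last exact: ltW.
have Nn : (N <= n)%N by rewrite leqNgt; apply/negP => /(eU _ _ EUx EUy).
rewrite invf_ple ?posrE// (le_trans (ltW (truncnS_gt _)))//.
by rewrite ler_nat ltnS.
Qed.

(** For each isolated family the space is cut into the complement of the
    closure [M] of its union, the traces on [M] of the open sets [U E] that miss
    every member but [E], and the rest of [M].  The traces are pairwise disjoint
    because [M] and [U E] only meet inside [closure E], which is what makes the
    partition locally trivial on every set.  The closures also separate points:
    in a Hausdorff space some member containing [x] has a closure that misses a
    given [y]. *)
Lemma fragmentable_of_network (R : realType) (Z : topologicalType) :
  hausdorff_space Z -> has_sigma_isolated_network Z -> fragmentable R Z.
Proof.
rewrite open_hausdorff => hZ [net netN [N isoN netE]].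
pose M n := closure (\bigcup_(A in N n) A).
pose U n E := ~` closure (\bigcup_(A in N n `\ E) A).
have oU n E : open (U n E) by apply: closed_openC; exact: closed_closure.
have UE n E x : N n E -> E x -> U n E x.
  by move=> NE Ex clx; have := isoN n E NE; rewrite -subset0 => /(_ x); apply.
have MUE n E x : M n x -> U n E x -> closure E x.
  move=> Mx Ux B Bx.
  have /Mx[y [[A NA Ay] [By Uy]]] : nbhs x (B `&` U n E).
    by apply: filterI => //; exact: open_nbhs_nbhs.
  exists y; split=> //; have [<- //|neq] := pselect (A = E).
  by exfalso; apply: Uy; apply: subset_closure; exists A.
pose e n x y := (M n x <-> M n y) /\
  (M n x -> forall E, N n E -> U n E x <-> U n E y).
apply: (@fragmentable_equivalences R Z e).
- by move=> n x.
- move=> n x y [Mxy Uxy]; split=> [|/Mxy /Uxy + E NE]; first by split=> /Mxy.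
  by move=> /(_ E NE) [? ?].
- move=> n x y z [Mxy Uxy] [Myz Uyz]; split; first exact: iff_trans Myz.
  move=> Mx E NE; apply: (iff_trans (Uxy Mx E NE)).
  by apply: Uyz => //; exact/Mxy.
- move=> n E0 E0n.
  (* A set not inside [M] is cut by its complement; a set inside [M] is cut by
     some [U E] that meets it, or else lies in the rest of [M]. *)
  have [E0M|] := pselect (E0 `<=` M n); last first.
    move=> /existsNP[x /not_implyP[E0x nMx]].
    exists (~` M n); split; [|by exists x|].
      by apply: closed_openC; exact: closed_closure.
    by move=> y z [_ nMy] [_ nMz]; split.
  have [[E [x [NE E0x Ux]]]|noU] :=
      pselect (exists E x, [/\ N n E, E0 x & U n E x]).
    exists (U n E); split=> //; first by exists x.
    have key y : (E0 `&` U n E) y -> forall F, N n F -> U n F y -> F = E.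
      move=> [/E0M My Uy] F NF UFy; apply: contrapT => neq.
      have [w [Ew UFw]] := MUE _ _ _ My Uy _ (open_nbhs_nbhs (conj (oU n F) UFy)).
      by apply: UFw; apply: subset_closure; exists E => //; split=> // /esym.
    move=> y z EUy EUz; split; first by split=> _; apply: E0M; [case: EUz|case: EUy].
    move=> _ F NF; split=> UF.
      by rewrite (key _ EUy _ NF UF); case: EUz.
    by rewrite (key _ EUz _ NF UF); case: EUy.
  exists setT; rewrite setIT; split=> //; first exact: openT.
  move=> y z E0y E0z; split; first by split=> _; exact: E0M.
  by move=> _ F NF; split=> UF; exfalso; apply: noU; exists F; [exists y|exists z].
- move=> x y exy; apply: contrapT => /eqP/hZ[[A B] /= [/set_mem Ax /set_mem By]].
  move=> [oA oB /eqP AB0].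
  have [E] := netN x A oA Ax; rewrite netE => -[n _ NE] [Ex EA].
  have Mx : M n x by apply: subset_closure; exists E.
  have [Mxy Uxy] := exy n.
  have Uy : U n E y by apply/(Uxy Mx E NE)/UE.
  have [w [/EA Aw Bw]] := MUE n E y (Mxy.1 Mx) Uy B (open_nbhs_nbhs (conj oB By)).
  by have : (A `&` B) w by []; rewrite AB0.
Qed.

Lemma subspace_network (Z : topologicalType) (S : set Z) :
  has_sigma_isolated_network Z -> has_sigma_isolated_network S.
Proof.
move=> [net netN [N isoN netE]].
pose tr (A : set Z) : set S := set_val @^-1` A.
exists (\bigcup_n (tr @` N n)); last first.
  exists (fun n => tr @` N n) => // n _ [E NE <-].
  rewrite -subset0 => x [Ex clx].
  have := isoN n E NE; rewrite -subset0 => /(_ (set_val x)); apply; split=> //.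
  move=> B /set_val_continuous /clx[y [[_ [[F NF <-] neq] Fy] By]].
  exists (set_val y); split=> //; exists F => //; split=> // eqFE.
  by apply: neq; rewrite /= eqFE.
move=> x _ [V oV <-] Vx.
have [E] := netN (set_val x) V oV Vx; rewrite netE => -[n _ NE] [Ex EV].
by exists (tr E); [exists n => //; exists E|split=> // y; exact: EV].
Qed.

(** * Sets of functions with the pointwise topology *)

Lemma compact_set_type (T : topologicalType) (A : set T) :
  compact A -> compact [set: A].
Proof.
move=> cA F FF _.
have [] := cA (set_val @ F).
  by apply: (@filterE _ F) => x; exact: set_valP.
move=> p [Ap clp]; exists (exist _ p (mem_set Ap)); split=> // B C FB.
move=> [_ [[V oV <-] Vp] VC].
have [] := clp (set_val @` B) V.
- by apply: (@filterS _ F) FB => x Bx; exists x.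
- exact: open_nbhs_nbhs.
by move=> _ [[x Bx <-] Vx]; exists x; split=> //; exact: VC.
Qed.

Lemma hausdorff_separating (T : topologicalType) (I : Type)
    (V : I -> topologicalType) (f : forall i, T -> V i) :
  (forall i, hausdorff_space (V i)) -> (forall i, continuous (f i)) ->
  (forall x y, (forall i, f i x = f i y) -> x = y) -> hausdorff_space T.
Proof.
move=> hV cf f_inj x y clxy; apply: f_inj => i; apply: hV => B C.
move=> /(cf i x) xB /(cf i y) yC.
by have [z [Bz Cz]] := clxy _ _ xB yC; exists (f i z).
Qed.

Lemma ptws_eval_continuous (I : Type) (V : topologicalType) (i : I) :
  continuous (fun f : {ptws I -> V} => f i).
Proof.
move=> f B; rewrite nbhsE => -[C [oC fC] CB].
have /cvg_sup/(_ i) : nbhs f --> f by exact: cvg_id.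
apply; exists ((fun h : I -> V => h i) @^-1` C).
by split=> // [|h /CB //]; exists C.
Qed.

Lemma ptws_cvg (I : Type) (V : topologicalType)
    (F : set_system {ptws I -> V}) (f : {ptws I -> V}) : Filter F ->
  (forall i, (fun h : {ptws I -> V} => h i) @ F --> f i) -> F --> f.
Proof.
move=> FF Ff; apply/cvg_sup => i A [_ [[B oB <-] fB BA]].
by apply: (@filterS _ F _ _ _ BA); apply: Ff; exact: open_nbhs_nbhs.
Qed.

Theorem lemma2p1 (R : realType) (Gamma : Type) (K : set {ptws Gamma -> R})
  (K01 : forall x, K x -> forall g, 0 <= x g <= 1)
  (Kcompact : compact K)
  (Kmin : forall x y, K x -> K y -> K (x \min y))
  (rho : K -> R)
  (rho01 : forall x, 0 <= rho x <= 1)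
  (rho_lsc : lower_semicontinuous (fun x : K => (rho x)%:E))
  (rho_star : forall x y : K,
     ((val y : Gamma -> R) < (val x : Gamma -> R))%O ->
     exists (alpha : R) (U : set K),
       [/\ alpha < rho x, open U, U y &
           forall z : K, U z ->
             ((val z : Gamma -> R) <= (val x : Gamma -> R))%O ->
             rho z < alpha]) :
  [/\ fragmentable R K,
      forall r : R, 0 <= r <= 1 ->
        has_sigma_isolated_network (rho @^-1` [set r]) &
      (forall x, K x -> forall g, x g = 0 \/ x g = 1) -> descriptive K].
Proof.
have valK (x : K) : K (val x) by exact: set_valP.
pose meet (x y : K) : K :=
  exist _ (val x \min val y) (mem_set (Kmin _ _ (valK x) (valK y))).
have meetE x y :
    meet y x = y <-> ((val y : Gamma -> R) <= (val x : Gamma -> R))%O.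
  split=> [<-|/lefP yx].
    by apply/lefP => g /=; rewrite ge_min lexx orbT.
  by apply: val_inj; apply/funext => g /=; rewrite min_l//; exact: yx.
pose coord (g : Gamma) (x : K) : R := val x g.
have coord_continuous g : continuous (coord g).
  move=> x.
  apply: (@continuous_comp K {ptws Gamma -> R} R set_val (fun f => f g)).
    exact: set_val_continuous.
  exact: ptws_eval_continuous.
have K_network : has_sigma_isolated_network K.
  apply: (@semilattice_network R K meet rho).
  - exact: compact_set_type.
  - by move=> x y z; apply: val_inj; apply/funext => g /=; exact: minA.
  - by move=> x y; apply: val_inj; apply/funext => g /=; exact: minC.
  - by move=> x; apply: val_inj; apply/funext => g /=; exact: minxx.
  - apply: (@continuous_comp_initial K (K * K)%type {ptws Gamma -> R} set_val
      (fun p => meet p.1 p.2)) => p.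
    apply: ptws_cvg => g.
    apply: (@continuous_min R (K * K)%type (fun q => coord g q.1)
      (fun q => coord g q.2) p).
      apply: (@continuous_comp _ _ _ fst (coord g)); first exact: cvg_fst.
      exact: coord_continuous.
    apply: (@continuous_comp _ _ _ snd (coord g)); first exact: cvg_snd.
    exact: coord_continuous.
  - by move=> a; have := (lower_semicontinuousP _).1 rho_lsc a.
  - move=> x y /meetE yx neq.
    have [|alpha [U [ax oU Uy Ualpha]]] := rho_star x y.
      by rewrite lt_neqAle yx andbT; apply/eqP => /val_inj.
    by exists alpha, U; split=> // z Uz /meetE; exact: Ualpha.
split.
- apply: fragmentable_of_network => //.
  apply: (hausdorff_separating K Gamma (fun=> R) coord) => // x y xy.
  by apply: val_inj; apply/funext.
- by move=> r _; exact: subspace_network.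
- by move=> _; split=> //; exact: compact_set_type.
Qed.
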